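(* Let $m\ge 0$ and $L\ge 1$, put $M=2^{K(m)}L$ and $N=2^M=B(m)^L$. Then \[ \sum_{\substack{0\le n<N\\ a_m(n)=0}} n^k=\sum_{\substack{0\le n<N\\ a_m(n)=1}} n^k\qquad\text{for } k=0,1,\dots,s_mL-1. \]
   Context: For $n\ge0$ write $b_p(n)=\lfloor n/2^p\rfloor\bmod 2$ for its binary digits; $\oplus$ is XOR and $\&$ is bitwise AND. For $m\ge 0$, $a_m(n)=\bigoplus_{p\ge0,\ p\,\&\,m=0} b_p(n)$ (this is the $m$-th iterate of the Thue--Morse transform starting from the Thue--Morse sequence; $a_0$ is the Thue--Morse sequence). Let $K(m)=\max(1,\lceil\log_2(m+1)\rceil)$, $B(m)=2^{2^{K(m)}}$, and $s_m=|\{p\in[0,2^{K(m)}):p\,\&\,m=0\}|=2^{K(m)-\mathrm{popcount}(m)}$, where $\mathrm{popcount}(m)$ is the number of $1$-bits of $m$. *)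

(* Defs.v *)
From mathcomp Require Import all_boot.

Set Implicit Arguments.
Unset Strict Implicit.
Unset Printing Implicit Defensive.

(* Binary digits are booleans (true = 1, false = 0), so XOR is [addb];
   [odd q] is [q %% 2] by [modn2]. Bitwise AND on nat is [Nat.land]. *)
Definition digit (p n : nat) : bool := odd (n %/ 2 ^ p).

(* The XOR over all p >= 0 has finite support: digit p n = 0 for p >= n, since
   n < 2 ^ n. It is therefore cut off at p < n; see [thue_morse_iter_trunc]. *)
Definition thue_morse_iter (m n : nat) : bool :=
  \big[addb/false]_(0 <= p < n | Nat.land p m == 0) digit p n.

Lemma digit_small (p n : nat) : n <= p -> digit p n = false.
Proof.
move=> le_np; rewrite /digit divn_small //.
exact: leq_ltn_trans le_np (ltn_expl p (ltnSn 1)).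
Qed.

Lemma thue_morse_iter_trunc (m n q : nat) : n <= q ->
  thue_morse_iter m n =
  \big[addb/false]_(0 <= p < q | Nat.land p m == 0) digit p n.
Proof.
move=> le_nq; rewrite (big_cat_nat (leq0n n) le_nq) /=.
rewrite [X in _ (+) X]big_nat_cond [X in _ (+) X]big1 ?addbF //.
by move=> p /andP[/andP[le_np _] _]; exact: digit_small.
Qed.

(* [up_log 2 m.+1] is the least e with m + 1 <= 2 ^ e, i.e. the ceiling of
   log_2 (m + 1). *)
Definition K (m : nat) : nat := maxn 1 (up_log 2 m.+1).

Definition B (m : nat) : nat := 2 ^ (2 ^ K m).

Definition s (m : nat) : nat :=
  #|[set p : 'I_(2 ^ K m) | Nat.land p m == 0]|.

(* Main.v *)
(* Prouhet-Tarry-Escott by induction on the number of binary digits.  Let T M k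
   be the sum of (-1)^chi(n) n^k over n < 2^M, where chi(n) is the XOR of the
   digits of n at the positions p < M that satisfy P.  Splitting off the top
   digit gives
     T (M + 1) k = T M k +/- sum_(j <= k) C(k, j) 2^(M (k - j)) T M j,
   with sign - exactly when P M holds.  In that case the two T M k cancel and
   only exponents j < k remain, so each position in P extends the range of
   vanishing exponents by one. *)
Require Import Defs.
From mathcomp Require Import all_boot.
From mathcomp Require Import ssralg ssrnum ssrint.
From Stdlib Require PeanoNat.

Set Implicit Arguments.
Unset Strict Implicit.
Unset Printing Implicit Defensive.

Import GRing.Theory Num.Theory.

(** The cutoff [M] does not depend on [n], which allows induction on [M]. *)
Definition xor_digits (P : pred nat) (M n : nat) : bool :=
  \big[addb/false]_(0 <= p < M | P p) digit p n.

Lemma digit_eq0 (p n : nat) : n < 2 ^ p -> digit p n = false.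
Proof. by move=> lt_n; rewrite /digit divn_small. Qed.

(** Dividing by [2 ^ p] turns the added term into [2 ^ (M - p)], which is even. *)
Lemma digitDexp (p M n : nat) : p < M -> digit p (2 ^ M + n) = digit p n.
Proof.
move=> lt_pM; rewrite /digit -(subnK (ltnW lt_pM)) expnD divnMDl ?expn_gt0 //.
by rewrite oddD oddX subn_eq0 leqNgt lt_pM.
Qed.

Lemma digit_top (M n : nat) : n < 2 ^ M -> digit M (2 ^ M + n) = true.
Proof.
by move=> lt_n; rewrite /digit -{1}(mul1n (2 ^ M)) divnMDl ?expn_gt0 // divn_small.
Qed.

Lemma xor_digitsS (P : pred nat) (M n : nat) :
  xor_digits P M.+1 n = xor_digits P M n (+) (P M && digit M n).
Proof.
rewrite /xor_digits big_mkcond big_nat_recr //= -big_mkcond /=.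
by case: (P M).
Qed.

Lemma xor_digits_low (P : pred nat) (M n : nat) : n < 2 ^ M ->
  xor_digits P M.+1 n = xor_digits P M n.
Proof. by move=> lt_n; rewrite xor_digitsS digit_eq0 // andbF addbF. Qed.

Lemma xor_digits_high (P : pred nat) (M n : nat) : n < 2 ^ M ->
  xor_digits P M.+1 (2 ^ M + n) = xor_digits P M n (+) P M.
Proof.
move=> lt_n; rewrite xor_digitsS digit_top // andbT; congr (_ (+) _).
rewrite /xor_digits big_nat_cond [RHS]big_nat_cond.
by apply: eq_bigr => p /andP[/andP[_ lt_pM] _]; rewrite digitDexp.
Qed.

(** The cutoffs [n] and [M] may come in either order, so both XORs are compared with the one cut off
    at [maxn n M]; the extra digits are 0. *)
Lemma thue_morse_iterE (m M n : nat) : n < 2 ^ M ->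
  thue_morse_iter m n = xor_digits (fun p => Nat.land p m == 0) M n.
Proof.
move=> lt_n; rewrite (thue_morse_iter_trunc m (leq_maxl n M)).
rewrite (big_cat_nat (leq0n M) (leq_maxr n M)) /=.
rewrite [X in _ (+) X]big_nat_cond [X in _ (+) X]big1 ?addbF //.
move=> p /andP[/andP[le_Mp _] _]; apply: digit_eq0.
by apply: leq_trans lt_n _; rewrite leq_exp2l.
Qed.

Section SignedPowerSums.
Local Open Scope ring_scope.

Definition signed_power_sum (P : pred nat) (M k : nat) : int :=
  \sum_(0 <= n < 2 ^ M) (-1) ^+ xor_digits P M n * n%:R ^+ k.

Lemma signed_power_sumS (P : pred nat) (M k : nat) :
  signed_power_sum P M.+1 k = signed_power_sum P M k +
    (-1) ^+ P M * \sum_(i < k.+1)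
      ((2 ^ M)%:R ^+ (k - i) *+ 'C(k, i)) * signed_power_sum P M i.
Proof.
rewrite {1}/signed_power_sum expnS mul2n -addnn.
rewrite (big_cat_nat (leq0n (2 ^ M)) (leq_addr _ _)) /=; congr (_ + _).
  rewrite big_nat [RHS]big_nat.
  by apply: eq_bigr => n /andP[_ lt_n]; rewrite xor_digits_low.
rewrite -{1}[(2 ^ M)%N]add0n big_addn addnK.
under [X in _ * X]eq_bigr do rewrite mulr_sumr.
rewrite exchange_big /= mulr_sumr big_nat [RHS]big_nat.
apply: eq_bigr => n /andP[_ lt_n].
rewrite [(n + _)%N]addnC xor_digits_high // signr_addb natrD exprDn !mulr_sumr.
apply: eq_bigr => i _.
rewrite !mulrnAl !mulrnAr; congr (_ *+ _).
by rewrite -mulrA mulrCA; congr (_ * _); rewrite mulrCA.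
Qed.

Lemma signed_power_sum_eq0 (P : pred nat) (M k : nat) :
  (k < \sum_(0 <= p < M | P p) 1)%N -> signed_power_sum P M k = 0.
Proof.
elim: M k => [|M IHM] k; first by rewrite big_nil.
rewrite big_mkcond big_nat_recr //= -big_mkcond /= => lt_k.
rewrite signed_power_sumS big_ord_recr /= subnn expr0 binn mulr1n mul1r.
(* The terms with [i < k] vanish by induction: whether or not [P M] holds, [k] is at most the number
   of positions below [M] in [P]. *)
rewrite big1 ?add0r => [|i _]; last first.
  rewrite IHM ?mulr0 //; apply: leq_trans (ltn_ord i) _.
  by move: lt_k; case: (P M); rewrite ?addn0 ?addn1 // => /ltnW.
move: lt_k; case: (P M) => lt_k; first by rewrite expr1 mulN1r subrr.
by rewrite IHM ?mulr0 ?addr0 // -[X in (_ < X)%N]addn0.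
Qed.

(** The sign is 1 on one class and -1 on the other, so the signed sum is the difference of the two
    power sums; the equality in [int] then descends to [nat]. *)
Lemma balanced_power_sum (P : pred nat) (M k : nat) :
  signed_power_sum P M k = 0 ->
  (\sum_(0 <= n < 2 ^ M | xor_digits P M n == false) n ^ k =
   \sum_(0 <= n < 2 ^ M | xor_digits P M n == true) n ^ k)%N.
Proof.
rewrite /signed_power_sum (bigID (fun n => xor_digits P M n == false)) /=.
under eq_bigr => n /eqP-> do rewrite expr0 mul1r.
under [X in _ + X]eq_bigr => n.
  rewrite eqbF_neg negbK => ->; rewrite expr1 mulN1r; over.
rewrite sumrN => /subr0_eq eq_sums; apply/eqP.
rewrite -(eqr_nat int) !natr_sum; apply/eqP.
under eq_bigr do rewrite natrX.
under [RHS]eq_bigr do rewrite natrX.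
by rewrite eq_sums; apply: eq_bigl => n; case: (xor_digits P M n).
Qed.

End SignedPowerSums.

(** All bits of [m] lie below [e], so [m] absorbs the mask [ones e], and masking by [ones e] is
    reduction modulo [2 ^ e]. *)
Lemma land_periodic (e m q r : nat) : m < 2 ^ e ->
  Nat.land (r + q * 2 ^ e) m = Nat.land r m.
Proof.
have powE : Nat.pow 2 e = 2 ^ e.
  by elim: e => // e IHe; rewrite expnS -IHe.
move=> /ltP lt_m; rewrite -powE in lt_m *.
have mE : Nat.land (PeanoNat.Nat.ones e) m = m.
  by rewrite PeanoNat.Nat.land_comm PeanoNat.Nat.land_ones
    PeanoNat.Nat.mod_small.
rewrite -mE !PeanoNat.Nat.land_assoc !PeanoNat.Nat.land_ones.
by rewrite PeanoNat.Nat.Div0.mod_add.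
Qed.

Lemma ltn_expK (m : nat) : m < 2 ^ K m.
Proof.
apply: leq_trans (up_logP m.+1 (ltnSn 1)) _.
by rewrite leq_exp2l // leq_maxr.
Qed.

(** By [land_periodic] the condition on [p] has period [2 ^ K m], so each of the [L] blocks of that
    length contributes [s m]. *)
Lemma count_disjoint_positions (m L : nat) :
  \sum_(0 <= p < 2 ^ K m * L | Nat.land p m == 0) 1 = s m * L.
Proof.
elim: L => [|L IHL]; first by rewrite !muln0 big_nil.
rewrite !mulnS addnC (big_cat_nat (leq0n _) (leq_addr _ _)) /= IHL addnC.
(* Only the last block remains; it is shifted to start at 0. *)
congr (_ + _); rewrite -{1}[2 ^ K m * L]add0n big_addn addKn.
rewrite /s cardsE -sum1_card big_mkord; apply: eq_bigl => p.
by rewrite unfold_in mulnC land_periodic ?ltn_expK.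
Qed.

Theorem theorem15 (m L : nat) (hL : 1 <= L) :
  let M := 2 ^ K m * L in
  let N := 2 ^ M in
  N = B m ^ L /\
  forall k : nat, k < s m * L ->
    \sum_(0 <= n < N | thue_morse_iter m n == false) n ^ k =
    \sum_(0 <= n < N | thue_morse_iter m n == true) n ^ k.
Proof.
move=> M N; split; first by rewrite /N /M /B -expnM.
move=> k lt_k.
have tmE b : \sum_(0 <= n < N | thue_morse_iter m n == b) n ^ k =
    \sum_(0 <= n < N | xor_digits (fun p => Nat.land p m == 0) M n == b) n ^ k.
  (* The bound [n < N = 2 ^ M] must enter the filter, since the two XORs are only known to agree
     there. *)
  rewrite big_nat_cond [RHS]big_nat_cond; apply: eq_bigl => n.
  by apply: andb_id2l => /andP[_ lt_n]; rewrite (thue_morse_iterE m lt_n).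
rewrite !tmE; apply/balanced_power_sum/signed_power_sum_eq0.
by rewrite count_disjoint_positions.
Qed.
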